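(* Let $\kappa\ge\nu\ge\omega$ be cardinals with $\nu$ regular, and let $n\ge1$ and $k\ge1$ be natural numbers. If $\mathcal A$ is a $(k+1,\nu)$-almost disjoint family of finite subsets of $\kappa^{+(n-1)}$ such that $|A|>n\cdot k$ for every $A\in\mathcal A$, then $\chi_{\rm CF}(\mathcal A)\le\kappa$.
   Context: A family $\mathcal A$ is $(\mu,\nu)$-almost disjoint if $|\bigcap\mathcal B|<\mu$ for every $\mathcal B\subseteq\mathcal A$ with $|\mathcal B|=\nu$. For a family $\mathcal A$ and cardinal $\rho$, $f:\bigcup\mathcal A\to\rho$ is a conflict free coloring of $\mathcal A$ if for every $A\in\mathcal A$ there is $\zeta<\rho$ with $|A\cap f^{-1}\{\zeta\}|=1$; $\chi_{\rm CF}(\mathcal A)$ is the least such $\rho$. $\kappa^{+(n-1)}$ is the $(n-1)$-th successor of $\kappa$ ($\kappa^{+0}=\kappa$). *)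

(* Defs.v *)
(* cardinals handled relationally via `#<=`/`#=` of
   mathcomp-analysis' cardinality.v; a cardinal is represented by a type
   (its full set). *)
From HB Require Import structures.
From mathcomp Require Import all_boot all_order all_algebra.
From mathcomp Require Import boolp classical_sets functions cardinality.
Set Implicit Arguments. Unset Strict Implicit. Unset Printing Implicit Defensive.
Local Open Scope classical_set_scope.
Local Open Scope card_scope.

Definition card_lt T U (A : set T) (B : set U) := A #<= B /\ ~ (B #<= A).

(* |X| is the cardinal successor of |Y|: |Y| < |X| and every set of
   cardinality < |X| (subsets of X suffice) has cardinality <= |Y|. *)
Definition is_card_succ (Y X : Type) :=
  card_lt [set: Y] [set: X] /\
  forall C : set X, card_lt C [set: X] -> C #<= [set: Y].

Fixpoint is_succ_iter (m : nat) (K X : Type) : Prop :=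
  match m with
  | 0 => [set: K] #= [set: X]
  | m'.+1 => exists Y : Type, is_succ_iter m' K Y /\ is_card_succ Y X
  end.

Definition regular_card (N : Type) :=
  infinite_set [set: N] /\
  forall (I : Type) (F : I -> set N),
    card_lt [set: I] [set: N] ->
    (forall i, card_lt (F i) [set: N]) ->
    \bigcup_i F i <> [set: N].

(* (mu, nu)-almost disjoint with mu = k+1 finite and nu = |N|:
   |⋂B| < k+1 for every subfamily B of size |N|. *)
Definition almost_disjoint X (N : Type) (k : nat) (A : set (set X)) :=
  forall B : set (set X), B `<=` A -> B #= [set: N] ->
    ~ (`I_k.+1 #<= \bigcap_(b in B) b).

Definition conflict_free X K (A : set (set X)) (f : X -> K) :=
  forall a, A a -> exists z : K, exists x : X, a `&` f @^-1` [set z] = [set x].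

(* Main.v *)
(* Call a set of the family fat for Q if it meets Q in more than k points. Each
   (k+1)-point set lies in fewer than nu members, so the union of the fat sets is
   no larger than an infinite Q of size at least nu, and, nu being regular, is
   smaller than kappa whenever Q is. By induction on n, the ground set is
   well-ordered by cutting it into blocks of size at most kappa and order type at
   most kappa, in such a way that every A in the family has more than k points in
   its last block: filter kappa^{+n} by fat-closed sets of size kappa^{+(n-1)};
   each A loses at most k points below its last layer, which is then treated
   inductively. Now colour greedily along this order: x avoids the colours of the
   smaller points in the union of the sets that are fat for the part of the block
   of x up to x. There are fewer than kappa of them, and the last point of A
   receives a colour that occurs nowhere else in A. *)
Require Import Defs.
From HB Require Import structures.
From mathcomp Require Import all_boot all_order all_algebra.
From mathcomp Require Import boolp classical_sets functions cardinality.
From mathcomp Require Import finmap.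
From mathcomp Require wochoice.
From Stdlib Require Import Wellfounded.
Set Implicit Arguments.
Unset Strict Implicit.
Unset Printing Implicit Defensive.
Local Open Scope classical_set_scope.
Local Open Scope card_scope.

(** * Cardinal comparison through injections *)

Definition inj_on T U (A : set T) (f : T -> U) :=
  forall x y, A x -> A y -> f x = f y -> x = y.

Lemma card_le_inj T U (A : set T) (B : set U) (f : T -> U) :
  (forall x, A x -> B (f x)) -> inj_on A f -> A #<= B.
Proof.
move=> fAB finj.
have [g] : $|{injfun A >-> B}|.
  apply/injfunPex; exists f; first by move=> x /fAB.
  by move=> x y /set_mem Ax /set_mem Ay; apply: finj.
exact: inj_card_le g.
Qed.

Lemma card_le_ex T U (A : set T) (B : set U) (u : U) : A #<= B ->
  exists f : T -> U, (forall x, A x -> B (f x)) /\ inj_on A f.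
Proof.
elim/Ppointed: U => U in B u *; first by case: (no u).
move=> /pcard_leP/injfunPex[f fAB finj]; exists f; split => [x /fAB //|x y Ax Ay].
by apply: finj; exact: mem_set.
Qed.

Lemma infinite_card_le T U (A : set T) (B : set U) :
  infinite_set A -> A #<= B -> infinite_set B.
Proof. by move=> iA AB fB; apply: iA; exact: card_le_finite AB fB. Qed.

Lemma not_card_le_set0 T U (A : set T) : infinite_set A -> ~ (A #<= @set0 U).
Proof. by move=> iA; rewrite card_le0 => /eqP A0; apply: iA; rewrite A0. Qed.

(* Hilbert's hotel: [x] is moved to the first term of a sequence of distinct
   elements of [A], and that sequence is shifted. *)
Lemma infinite_card_setU1 T (A : set T) (x : T) :
  infinite_set A -> x |` A #<= A.
Proof.
move=> /infiniteP/(card_le_ex x)[h [hA hinj]].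
have [Ax|nAx] := pselect (A x).
  by apply: subset_card_le => y [->|].
have /choice[g gP] : forall y, exists z,
    (y = x -> z = h 0%N) /\ (forall i, y = h i -> z = h i.+1) /\
    (y <> x -> (forall i, y <> h i) -> z = y).
  move=> y; have [->|yx] := pselect (y = x).
    exists (h 0%N); split=> //; split=> [i xh|//].
    by case: nAx; rewrite xh; exact: hA.
  have [[i yi]|nyi] := pselect (exists i, y = h i).
    exists (h i.+1); split=> //; split=> [j|_ /(_ i)//].
    by rewrite yi => /hinj ->.
  exists y; split=> //; split=> // i yi.
  by case: nyi; exists i.
have gE y : (x |` A) y -> (y = x /\ g y = h 0%N) \/
    (exists2 i, y = h i & g y = h i.+1) \/ (A y /\ g y = y /\ forall i, y <> h i).
  move=> xAy; have [g1 [g2 g3]] := gP y.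
  have [yx|yx] := pselect (y = x); first by left; split=> //; exact: g1.
  right; have [[i yi]|nyi] := pselect (exists i, y = h i).
    by left; exists i => //; exact: g2.
  right; have nh i : y <> h i by move=> yi; apply: nyi; exists i.
  by split; [case: xAy | split=> //; exact: g3].
apply: (card_le_inj (f := g)).
  move=> y /gE[[_ ->]|[[i _ ->]|[Ay [-> _]]]] //; exact: hA.
move=> y z /gE[[-> ->]|[[i -> ->]|[Ay [-> ny]]]]
           /gE[[-> ->]|[[j -> ->]|[Az [-> nz]]]] //.
- by move/hinj => /(_ I I).
- by move=> /esym/nz.
- by move/hinj => /(_ I I).
- by move/hinj => /(_ I I) [->].
- by move=> /esym/nz.
- by move=> /ny.
- by move=> /ny.
Qed.

Lemma not_card_le_setU1 T U (D : set U) (A : set T) (x : T) :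
  infinite_set D -> ~ (D #<= A) -> ~ (D #<= x |` A).
Proof.
move=> iD DA DxA; have [fA|iA] := pselect (finite_set A).
  apply: (infinite_card_le iD DxA); rewrite finite_setU; split.
    exact: finite_set1.
  exact: fA.
by apply: DA; apply: card_le_trans DxA _; exact: infinite_card_setU1.
Qed.

(** * Well-orders and greedy choice along them *)

Definition wo T (lt : T -> T -> Prop) :=
  well_founded lt /\ forall x y, lt x y \/ x = y \/ lt y x.

Section WellOrders.
Variables (T : Type) (lt : T -> T -> Prop).

Lemma wf_irr : well_founded lt -> forall x, ~ lt x x.
Proof.
by move=> wf x; elim/(well_founded_ind wf): x => x IH lxx; exact: (IH _ lxx lxx).
Qed.

Lemma wf_min (P : T -> Prop) : well_founded lt -> (exists x, P x) ->
  exists2 x, P x & forall y, lt y x -> ~ P y.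
Proof.
move=> wf [x Px]; apply: contrapT => nomin; move: Px.
elim/(well_founded_ind wf): x => x IH Px.
by apply: nomin; exists x => // y yx /(IH _ yx).
Qed.

Hypothesis wolt : wo lt.

Lemma wo_asym x y : lt x y -> ~ lt y x.
Proof.
case: wolt => wf _; elim/(well_founded_ind wf): x y => x IH y xy yx.
exact: (IH _ yx _ yx xy).
Qed.

Lemma wo_trans y x z : lt x y -> lt y z -> lt x z.
Proof.
case: wolt => wf tri xy yz.
have [//|[xz|zx]] := tri x z; first by case: (wo_asym xy); rewrite xz.
exfalso; elim/(well_founded_ind wf): x y z xy yz zx => x IH y z xy yz zx.
exact: (IH _ zx _ _ zx xy yz).
Qed.

End WellOrders.

Lemma wo_inv_image T U (lt : U -> U -> Prop) (f : T -> U) :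
  wo lt -> injective f -> wo (fun x y => lt (f x) (f y)).
Proof.
move=> [wf tri] finj; split; first exact: wf_inverse_image.
move=> x y; have [|[/finj|]] := tri (f x) (f y); by [left | right; left | right; right].
Qed.

Definition lexprod T U (lt : T -> T -> Prop) (lu : U -> U -> Prop) (p q : T * U) :=
  lt p.1 q.1 \/ (p.1 = q.1 /\ lu p.2 q.2).

Lemma wo_lexprod T U (lt : T -> T -> Prop) (lu : U -> U -> Prop) :
  wo lt -> wo lu -> wo (lexprod lt lu).
Proof.
move=> [wft trit] [wfu triu]; split.
  case=> x y; elim/(well_founded_ind wft): x y => x IHx y.
  elim/(well_founded_ind wfu): y => y IHy; constructor=> -[x' y'] /=.
  by case=> /= [/IHx|[-> /IHy]].
move=> [x y] [x' y'] /=.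
have [|[->|]] := trit x x'; [by left; left | | by right; right; left].
have [|[->|]] := triu y y'; [by left; right | by right; left | by right; right; right].
Qed.

Lemma exists_wo (T : Type) : exists lt : T -> T -> Prop, wo lt.
Proof.
have [R Rwo] := wochoice.well_ordering_principle {classic T}.
exists (fun x y => x <> y /\ R x y).
have Rmin (P : {classic T} -> Prop) : (exists x, P x) ->
    exists2 x, P x & forall y, P y -> R x y.
  move=> [x Px].
  have [|z [[zP zmin] _]] := Rwo [pred y | `[< P y >]].
    by exists x; exact: asboolT.
  exists z; first exact: asboolW zP.
  by move=> y Py; apply: zmin; exact: asboolT.
have Ranti : antisymmetric R.
  move=> x y; apply: (@wochoice.wo_chain_antisymmetric _ R predT) => //.
  exact: wochoice.withinW.
split.
  move=> x; apply: contrapT => nx.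
  have [z nz zmin] := Rmin _ (ex_intro (fun y => ~ Acc _ y) x nx).
  apply: nz; constructor=> y [yz Ryz]; apply: contrapT => /zmin Rzy.
  by apply: yz; apply: Ranti; rewrite Ryz Rzy.
move=> x y; have [|xy] := pselect (x = y); first by right; left.
have [z [] -> zmin] := Rmin (fun z => z = x \/ z = y) (ex_intro _ x (or_introl erefl)).
  by left; split=> //; apply: zmin; right.
by right; right; split; [exact/nesym | apply: zmin; left].
Qed.

(** At [x] the forbidden colours form an image of part of [B x], so they cannot exhaust [D]. Besides
    the final colouring, this yields comparability of cardinals and Hessenberg's theorem. *)
Lemma greedy_coloring X K (lt : X -> X -> Prop) (D : set K) (B : X -> set X) :
  well_founded lt -> (forall x, ~ (D #<= B x)) ->
  exists f : X -> K, (forall x, D (f x)) /\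
    forall x y, B x y -> lt y x -> f y <> f x.
Proof.
move=> wf DB.
have step x (g : forall y, lt y x -> K) :
    {z : K | D z /\ forall y (yx : lt y x), B x y -> g y yx <> z}.
  apply: cid; apply: contrapT => none; apply: (DB x).
  (* Extending [g] by [None] off the predecessors of [x] turns the used colours into an image of
     [B x]. *)
  pose h y := if pselect (lt y x) is left yx then Some (g y yx) else None.
  have sub : some @` D `<=` h @` B x.
    move=> _ [z Dz <-]; apply: contrapT => nz; apply: none; exists z; split=> //.
    move=> y yx Bxy gz; apply: nz; exists y => //.
    by rewrite /h; case: pselect => // yx'; rewrite (Prop_irrelevance yx' yx) gz.
  rewrite -card_ge_some; apply: card_le_trans (subset_card_le sub) _.
  exact: card_image_le.
pose f := Fix wf (fun _ => K) (fun x g => sval (step x g)).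
have fE x : f x = sval (step x (fun y _ => f y)).
  rewrite /f Fix_eq // => {}x g g' gg'.
  suff -> : g = g' by [].
  apply: functional_extensionality_dep => y.
  by apply: functional_extensionality_dep => yx.
have fP x : D (f x) /\ forall y, lt y x -> B x y -> f y <> f x.
  by rewrite fE; exact: svalP (step x _).
by exists f; split=> [x|x y Bxy yx]; have [Dfx fx] := fP x; last exact: fx.
Qed.

(** With the constant conflict set [A], a greedy colouring by [B] is injective on [A]. *)
Lemma card_le_total T U (A : set T) (B : set U) : ~ (B #<= A) -> A #<= B.
Proof.
move=> BA; have [lt [wf tri]] := exists_wo T.
have [|f [fB fne]] := @greedy_coloring T U lt B (fun _ => A) wf; first by [].
apply: (card_le_inj (f := f)) => // x y Ax Ay fxy.
have [xy|[//|yx]] := tri x y; first by case: (fne y x).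
by case: (fne x y).
Qed.

(** If some initial segment is as large as [T], take the least [x] with such a segment and pull the
    order back along an injection of [T] into it. Segments of the new order embed in segments
    strictly below [x], which are small by minimality. *)
Lemma exists_initial_wo (T : Type) : exists lt : T -> T -> Prop,
  wo lt /\ forall x, ~ ([set: T] #<= [set y | lt y x]).
Proof.
have [lt wolt] := exists_wo T.
have [[x0 big]|small] := pselect (exists x, [set: T] #<= [set y | lt y x]); last first.
  by exists lt; split=> // x Tx; apply: small; exists x.
have [x bigx xmin] := wf_min wolt.1 (ex_intro (fun x => _ #<= [set y | lt y x]) x0 big).
have [g [gx ginj]] := card_le_ex x0 bigx.
have {}ginj : injective g by move=> y z; exact: ginj.
exists (fun y z => lt (g y) (g z)); split; first exact: wo_inv_image.
move=> t /card_le_trans bigt; apply: (xmin (g t)); first exact: gx.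
by apply: bigt; apply: (card_le_inj (f := g)) => // y z _ _; exact: ginj.
Qed.

(** * Products and unions of infinite cardinals *)

Lemma card_le_setX T T' U U' (A : set T) (A' : set T') (B : set U) (B' : set U') :
  A #<= A' -> B #<= B' -> A `*` B #<= A' `*` B'.
Proof.
have [->|/set0P[a' _] AA'] := eqVneq A' set0.
  by rewrite card_le0 => /eqP-> _; rewrite set0X card_ge0.
have [->|/set0P[b' _] BB'] := eqVneq B' set0.
  by rewrite card_le0 => /eqP->; rewrite setX0 card_ge0.
have [f0 [f0A f0inj]] := card_le_ex a' AA'.
have [g0 [g0B g0inj]] := card_le_ex b' BB'.
apply: (card_le_inj (f := fun p => (f0 p.1, g0 p.2))).
  by move=> [x y] [/f0A ? /g0B].
by move=> [x y] [x' y'] [/= Ax By] [/= Ax' By'] [/f0inj-> // /g0inj->].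
Qed.

(* Hessenberg's argument: order the pairs by their maximum first. A pair whose
   maximum is [m] has its predecessors in the square of [m |` seg m], which is
   smaller than [S], so a greedy choice of distinct values in [S] never fails. *)
Lemma card_le_setX_step T (lt : T -> T -> Prop) (S : set T) :
  wo lt -> infinite_set S ->
  (forall m, S m -> ~ (S #<= [set y | lt y m])) ->
  (forall m, S m -> infinite_set [set y | lt y m] ->
    [set y | lt y m] `*` [set y | lt y m] #<= [set y | lt y m]) ->
  S `*` S #<= S.
Proof.
move=> wolt iS Sseg segX.
pose mx (p : T * T) := if `[< lt p.1 p.2 >] then p.2 else p.1.
have le1 p : (mx p |` [set y | lt y (mx p)]) p.1.
  by rewrite /mx; case: asboolP; [right | left].
have le2 p : (mx p |` [set y | lt y (mx p)]) p.2.
  rewrite /mx; case: asboolP => [|nlt]; first by left.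
  by have [|[|]] := wolt.2 p.1 p.2; [| left | right].
have Smx p : S p.1 -> S p.2 -> S (mx p) by rewrite /mx; case: asboolP.
have woltX := wo_lexprod wolt (wo_lexprod wolt wolt).
(* The pair itself serves as tie-breaker, which makes the pulled-back map injective. *)
have wolt2 := wo_inv_image woltX (f := fun p => (mx p, p)) (fun p q e => congr1 snd e).
set lt2 := (X in wo X) in wolt2.
have lt2_mx q p : lt2 q p -> mx q = mx p \/ lt (mx q) (mx p).
  by case=> /= [|[]]; [right | left].
have sub_mx q p : lt2 q p -> mx q |` [set y | lt y (mx q)] `<=`
    mx p |` [set y | lt y (mx p)].
  move=> /lt2_mx[->//|qp] y [->|yq]; right=> //.
  exact: wo_trans wolt _ _ _ yq qp.
(* Outside the square of [S] the conflict set is empty, because the greedy lemma wants it small at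
   every pair. *)
pose B p := [set q | S p.1 /\ S p.2 /\ lt2 q p].
have [|f [fS fne]] := @greedy_coloring _ T lt2 S B wolt2.1.
  move=> p SB; have [Sp|nSp] := pselect (S p.1 /\ S p.2); last first.
    apply: (@not_card_le_set0 _ T S iS); apply: card_le_trans SB _.
    by rewrite card_le0; apply/eqP/seteqP; split=> // q [p1 [p2 _]]; case: nSp.
  set m := mx p; have Sm : S m by apply: Smx; case: Sp.
  have BC : B p `<=` (m |` [set y | lt y m]) `*` (m |` [set y | lt y m]).
    by move=> q [_ [_ /sub_mx qp]]; split; apply: qp.
  have {BC} SC := card_le_trans SB (subset_card_le BC).
  have [fseg|iseg] := pselect (finite_set [set y | lt y m]).
    apply: (infinite_card_le iS SC).
    by apply: finite_setX; rewrite finite_setU; split=> //; exact: finite_set1.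
  apply: (Sseg m Sm); apply: card_le_trans SC _.
  apply: card_le_trans (segX m Sm iseg).
  by apply: card_le_setX; exact: infinite_card_setU1.
apply: (card_le_inj (f := f)) => [p _|p q [p1 p2] [q1 q2] fpq]; first exact: fS.
have [pq|[//|qp]] := wolt2.2 p q.
  by case: (fne q p).
by case: (fne p q).
Qed.

Lemma infinite_card_setX T (A : set T) : infinite_set A -> A `*` A #<= A.
Proof.
have seg U (lt : U -> U -> Prop) : wo lt -> forall x : U,
    infinite_set [set y | lt y x] ->
    [set y | lt y x] `*` [set y | lt y x] #<= [set y | lt y x].
  move=> wolt x; elim/(well_founded_ind wolt.1): x => x IH ix.
  (* Either a shorter segment is as large, and its square bound carries over, or every shorter
     segment is strictly smaller and the previous lemma applies. *)
  have [[y yx xy]|small] := pselect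
      (exists2 y, lt y x & [set z | lt z x] #<= [set z | lt z y]).
    apply: card_le_trans (card_le_setX xy xy) _.
    apply: card_le_trans (IH y yx (infinite_card_le ix xy)) _.
    by apply: subset_card_le => z zy; exact: wo_trans wolt _ _ _ zy yx.
  apply: (card_le_setX_step wolt ix) => [y yx xy|y yx iy]; last exact: IH.
  by apply: small; exists y.
have full U : infinite_set [set: U] -> [set: U] `*` [set: U] #<= [set: U].
  move=> iU; have [lt [wolt init]] := exists_initial_wo U.
  by apply: (card_le_setX_step wolt iU) => m _; [exact: init | exact: seg].
move=> iA; have /card_eqPle[TA AT] := card_setT A.
apply: card_le_trans (card_le_setX AT AT) _; apply: card_le_trans TA.
by apply: full; exact: infinite_card_le iA AT.
Qed.

(** Code a point by an index of a set containing it and its code in that set; this lands in the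
    square of [W]. *)
Lemma card_le_bigcup I T V (D : set I) (F : I -> set T) (W : set V) :
  infinite_set W -> D #<= W -> (forall i, D i -> F i #<= W) ->
  \bigcup_(i in D) F i #<= W.
Proof.
move=> iW DW FW; have [v Wv] := infinite_setN0 iW.
have [d [dW dinj]] := card_le_ex v DW.
have /choice[e eP] : forall i, exists e : T -> V,
    D i -> (forall x, F i x -> W (e x)) /\ inj_on (F i) e.
  move=> i; have [Di|nDi] := pselect (D i); last by exists (fun=> v).
  by have [e eP] := card_le_ex v (FW i Di); exists e.
set UF := \bigcup_(i in D) F i.
have [->|/set0P[x0 [i0 _ _]]] := eqVneq UF set0; first exact: card_ge0.
have /choice[ix ixP] : forall x, exists i, UF x -> D i /\ F i x.
  move=> x; have [[i Di Fix]|nx] := pselect (UF x); first by exists i.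
  by exists i0.
apply: card_le_trans (infinite_card_setX iW).
apply: (card_le_inj (f := fun x => (d (ix x), e (ix x) x))).
  move=> x /ixP[Di Fi]; split=> /=; first exact: dW.
  exact: (eP _ Di).1.
move=> x y /ixP[Dx Fx] /ixP[Dy Fy] [/dinj ixy]; rewrite ixy // in Fx *.
exact: (eP _ Dy).2.
Qed.

Lemma card_le_setU T V (A B : set T) (W : set V) :
  infinite_set W -> A #<= W -> B #<= W -> A `|` B #<= W.
Proof.
move=> iW AW BW; rewrite -bigcup2E.
apply: (@card_le_bigcup nat) => [//||[|[|n]] _ //=].
exact/infiniteP.
Qed.

(** * Counting points by duplicate-free lists *)

Definition atleast (X : eqType) (j : nat) (S : set X) :=
  exists s : seq X, [/\ uniq s, (j <= size s)%N & forall x, x \in s -> S x].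

Lemma atleastP (X : choiceType) j (S : set X) : `I_j #<= S <-> atleast j S.
Proof.
split=> [/card_subP[C Cj CS]|[s [us js sS]]].
  have fC : finite_set C by exists j.
  exists (enum_fset (fset_set C)); split; first exact: fset_uniq.
    by rewrite -[X in (X <= _)%N](card_fset_set Cj).
  by move=> x; rewrite in_fset_set // => /set_mem /CS.
case: s us js sS => [|x0 s] us js sS.
  by move: js; rewrite leqn0 => /eqP->; rewrite II0 card_ge0.
apply: (card_le_inj (f := nth x0 (x0 :: s))) => [i /= ij|i i' /= ij i'j].
  by apply/sS/mem_nth; exact: leq_trans js.
by move/eqP; rewrite nth_uniq ?(leq_trans _ js) // => /eqP.
Qed.

(** The rank [r] may fail to be injective, hence the maximum is stated up to equality of ranks;
    layers of a filtration are compared this way. *)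
Lemma wo_seq_max (X : eqType) W (lt : W -> W -> Prop) (r : X -> W) (s : seq X) :
  wo lt -> s != [::] ->
  exists2 x, x \in s & forall y, y \in s -> r y = r x \/ lt (r y) (r x).
Proof.
move=> wolt; elim: s => // x [_ _|x' s /(_ isT)[z zs zmax] _].
  by exists x; rewrite ?mem_head // => y; rewrite inE => /eqP->; left.
have [xz|xz] := pselect (lt (r z) (r x)).
  exists x; rewrite ?mem_head // => y; rewrite inE => /predU1P[->|/zmax[->|yz]].
  - by left.
  - by right.
  - by right; exact: wo_trans wolt _ _ _ yz xz.
exists z; first by rewrite inE zs orbT.
move=> y; rewrite inE => /predU1P[->|/zmax//].
by have [|[|/xz]] := wolt.2 (r x) (r z); [right | left |].
Qed.

(** * Size of fat unions and closure under them *)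

Section FatUnion.
Variables (X : choiceType) (N : Type) (k : nat) (A : set (set X)).

Definition fat_union (Q : set X) : set X :=
  \bigcup_(a in [set a | A a /\ atleast k.+1 (a `&` Q)]) a.

Lemma fat_union_sub (Q : set X) a :
  A a -> atleast k.+1 (a `&` Q) -> a `<=` fat_union Q.
Proof. by move=> Aa aQ x ax; exists a. Qed.

Lemma fat_unionS (Q Q' : set X) : Q `<=` Q' -> fat_union Q `<=` fat_union Q'.
Proof.
move=> QQ' x [a [Aa [s [us ks sQ]]] ax]; exists a => //; split=> //.
by exists s; split=> // y /sQ[ay /QQ'].
Qed.

Hypotheses (iN : infinite_set [set: N]) (adA : almost_disjoint N k A).
Hypothesis finA : forall a, A a -> finite_set a.

(* Choosing the [k.+1] points of [Q] one at a time keeps every union indexed by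
   [Q] itself, and the last union runs over fewer than [N] sets. *)
Lemma fat_union_small (P : forall T, set T -> Prop) :
  (forall T (B C : set T), B `<=` C -> P T C -> P T B) ->
  (forall I T (D : set I) (F : I -> set T),
    P I D -> (forall i, D i -> P T (F i)) -> P T (\bigcup_(i in D) F i)) ->
  (forall T (B : set T), ~ ([set: N] #<= B) -> P T B) ->
  forall Q : set X, P X Q -> P X (fat_union Q).
Proof.
move=> Psub Pbig Plt Q PQ.
(* The list [s] holds the points chosen so far, and [j] counts those still to be found in [Q]
   outside [s]. *)
pose U j (s : seq X) : set X := \bigcup_(a in [set a | A a /\
  [set` s] `<=` a /\ exists t, [/\ uniq (s ++ t), (j <= size t)%N &
     forall x, x \in t -> (a `&` Q) x]]) a.
suff PU j s : (k < size s + j)%N -> P X (U j s).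
  apply: (Psub _ _ (U k.+1 [::])); last exact: PU.
  move=> x [a [Aa [s [us ks sQ]]] ax]; exists a => //; split=> //.
  by split=> //; exists s.
elim: j s => [|j IH] s ks.
  pose D := [set a | A a /\ ([set` s] `<=` a /\ uniq s)].
  apply: (Psub _ _ (\bigcup_(a in D) a)).
    move=> x [a [Aa [sa [t []]]]]; rewrite cat_uniq => /andP[us _] _ _ ax.
    by exists a.
  apply: Pbig => [|a [Aa _]]; last first.
    by apply: Plt => Na; apply: (infinite_card_le iN Na); exact: finA.
  (* All members indexed by [D] contain the more than [k] points of [s], so [N] many of them would
     contradict almost disjointness. *)
  apply: Plt => /card_subP[C CN CD].
  apply: (adA (B := C)) => // [a /CD[]//|].
  have [c Cc] : C !=set0.
    by apply: infinite_setN0 => fC; apply: iN; rewrite -(eq_finite_set CN).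
  apply/atleastP; exists s; split; first by have [_ []] := CD c Cc.
    by rewrite addn0 in ks.
  by move=> x xs a /CD[_ [sa _]]; exact: sa.
apply: (Psub _ _ (\bigcup_(q in Q) U j (q :: s))).
  move=> x [a [Aa [sa [[|q t] [//= us jt tQ]]]] ax].
  have [aq Qq] := tQ q (mem_head _ _).
  exists q => //; exists a => //; split=> //; split.
    by move=> y /=; rewrite inE => /predU1P[->//|/sa].
  exists t; split=> //; last by move=> y yt; apply: tQ; rewrite inE yt orbT.
  by move: us; rewrite -cat_rcons -cats1 -catA uniq_catCA.
by apply: Pbig => // q _; apply: IH; rewrite /= addSnnS.
Qed.

Lemma fat_union_card_le V (D : set V) (Q : set X) :
  infinite_set D -> [set: N] #<= D -> Q #<= D -> fat_union Q #<= D.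
Proof.
move=> iD ND QD; apply: (@fat_union_small (fun T (B : set T) => B #<= D)) => //.
- by move=> T B C /subset_card_le BC; exact: card_le_trans BC.
- by move=> I T E F; exact: card_le_bigcup.
- by move=> T B NB; apply: card_le_trans (card_le_total NB) ND.
Qed.

(** An injection of [N] into the union would pull the sets [F i] back to a cover of [N] by few small
    sets, indexed by the subtype of [D]. *)
Lemma regular_bigcup J T (D : set J) (F : J -> set T) : regular_card N ->
  ~ ([set: N] #<= D) -> (forall i, D i -> ~ ([set: N] #<= F i)) ->
  ~ ([set: N] #<= \bigcup_(i in D) F i).
Proof.
move=> [_ regN] ND NF NU.
have [x0 _] : (\bigcup_(i in D) F i) !=set0.
  by apply: infinite_setN0; exact: infinite_card_le iN NU.
have [g [gU ginj]] := card_le_ex x0 NU.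
apply: (regN D (fun i => [set n | F (val i) (g n)])).
- have /card_eqPle[TD DT] := card_setT D; split.
    exact: card_le_trans TD (card_le_total ND).
  by move=> NT; apply: ND; exact: card_le_trans NT TD.
- move=> i; split; first exact: card_leT.
  move=> Ni; apply: (NF (val i) (set_mem (valP i))); apply: card_le_trans Ni _.
  by apply: (card_le_inj (f := g)) => // n m _ _; exact: ginj.
- apply/seteqP; split=> // n _; have [i Di Fi] := gU n I.
  by exists (SigSub (mem_set Di)).
Qed.

(** If [Q] has at least [N] points, its fat union is no larger than [Q]; otherwise regularity keeps
    the fat union below [N], hence below [K]. *)
Lemma not_card_le_fat_union K (Q : set X) :
  regular_card N -> [set: N] #<= [set: K] ->
  ~ ([set: K] #<= Q) -> ~ ([set: K] #<= fat_union Q).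
Proof.
move=> regN NK KQ; have [NQ|NQ] := pselect ([set: N] #<= Q).
  move=> /card_le_trans Kfat; apply/KQ/Kfat.
  by apply: fat_union_card_le => //; exact: infinite_card_le iN NQ.
suff Nfat : ~ ([set: N] #<= fat_union Q) by move=> /(card_le_trans NK).
apply: (@fat_union_small (fun T (B : set T) => ~ ([set: N] #<= B))) => //.
  by move=> T B C /subset_card_le BC NC /card_le_trans NB; apply/NC/NB.
by move=> I T D F; exact: regular_bigcup.
Qed.

Definition fat_iter (Q : set X) n := iter n (fun Q => Q `|` fat_union Q) Q.
Definition fat_closure (Q : set X) : set X := \bigcup_n fat_iter Q n.

Lemma fat_closureS (Q Q' : set X) :
  Q `<=` Q' -> fat_closure Q `<=` fat_closure Q'.
Proof.
move=> QQ'; apply: subset_bigcup => n _; elim: n => //= n IH.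
exact: setUSS IH (fat_unionS IH).
Qed.

Lemma sub_fat_closure (Q : set X) : Q `<=` fat_closure Q.
Proof. by move=> x Qx; exists 0%N. Qed.

Lemma fat_iter_le Q m n : (m <= n)%N -> fat_iter Q m `<=` fat_iter Q n.
Proof.
move=> /subnK <-; elim: (n - m)%N => // p IH.
by apply: subset_trans IH _ => x ?; left.
Qed.

(** The stages increase, so finitely many witnesses already lie in one of them, and the next stage
    swallows [a]. Hence countably many stages suffice. *)
Lemma fat_closure_closed (Q : set X) a : A a ->
  atleast k.+1 (a `&` fat_closure Q) -> a `<=` fat_closure Q.
Proof.
move=> Aa [s [us ks sQ]].
have [n sn] : exists n, forall x, x \in s -> fat_iter Q n x.
  have {us ks} : forall x, x \in s -> fat_closure Q x by move=> x /sQ[].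
  elim: s {sQ} => [_|x s IH sQ]; first by exists 0%N.
  have [y ys|n sn] := IH; first by apply: sQ; rewrite inE ys orbT.
  have [m _ xm] := sQ x (mem_head _ _).
  exists (maxn m n) => y; rewrite inE => /predU1P[->|/sn].
    by move: xm; apply: fat_iter_le; exact: leq_maxl.
  by apply: fat_iter_le; exact: leq_maxr.
move=> x ax; exists n.+1 => //; right; apply: fat_union_sub ax => //.
by exists s; split=> // y ys; split; [have [] := sQ y ys | exact: sn].
Qed.

Lemma fat_closure_card_le V (D : set V) (Q : set X) :
  infinite_set D -> [set: N] #<= D -> Q #<= D -> fat_closure Q #<= D.
Proof.
move=> iD ND QD; apply: card_le_bigcup => //; first exact/infiniteP.
move=> n _; elim: n => //= n IH.
by apply: card_le_setU => //; exact: fat_union_card_le.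
Qed.

End FatUnion.

Lemma atleast_sub (X : eqType) i j (S S' : set X) :
  (j <= i)%N -> S `<=` S' -> atleast i S -> atleast j S'.
Proof.
move=> ji SS' [s [us si sS]]; exists s; split=> //; first exact: leq_trans si.
by move=> x /sS/SS'.
Qed.

Lemma atleast_split (X : eqType) i j (S S' : set X) :
  atleast (i + j)%N S -> ~ atleast j.+1 (S `\` S') -> atleast i (S `&` S').
Proof.
move=> [s [us ijs sS]] nj; pose P x := `[< S' x >].
have le_j : (size [seq x <- s | predC P x] <= j)%N.
  rewrite leqNgt; apply/negP => js; apply: nj.
  exists [seq x <- s | predC P x]; split=> //; first exact: filter_uniq.
  by move=> x; rewrite mem_filter => /andP[/asboolP nSx /sS].
exists [seq x <- s | P x]; split; first exact: filter_uniq.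
  rewrite -(leq_add2r j); apply: leq_trans ijs _.
  by rewrite -(count_predC P s) -!size_filter leq_add2l.
by move=> x; rewrite mem_filter => /andP[/asboolP Sx /sS].
Qed.

Lemma succ_iter_card_le m (K Z : Type) : is_succ_iter m K Z -> [set: K] #<= [set: Z].
Proof.
elim: m Z => [Z /card_eqPle[]//|m IH Z [Y [/IH KY [[YZ _] _]]]].
exact: card_le_trans KY YZ.
Qed.

(** * Well-ordering the ground set in small blocks *)

Section Rank.
Variables (X : choiceType) (N K : Type) (k : nat) (A : set (set X)).
Hypotheses (iN : infinite_set [set: N]) (adA : almost_disjoint N k A).
Hypotheses (finA : forall a, A a -> finite_set a) (NK : [set: N] #<= [set: K]).

(* [Q x] is the part, up to [x], of the block of size at most [K] containing [x];
   the last block met by [a] contains more than [k] points of [a]. *)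
Definition last_block W (lt : W -> W -> Prop) (S : set X) (p : nat)
    (r : X -> W) (Q : X -> set X) :=
  [/\ inj_on S r, forall x, ~ ([set: K] #<= Q x) &
    forall a x, A a -> atleast p (a `&` S) -> (a `&` S) x ->
      (forall y, (a `&` S) y -> r y = r x \/ lt (r y) (r x)) ->
      atleast k.+1 (a `&` Q x)].

Let iK : infinite_set [set: K] := infinite_card_le iN NK.

(** A single block suffices: [Q x] is the initial segment up to [x]. The order is chosen before [S],
    so that in the inductive step all layers share one order. *)
Lemma last_block_base : exists (W : Type) (lt : W -> W -> Prop), wo lt /\
  forall S : set X, S #<= [set: K] -> exists r Q, last_block lt S k.+1 r Q.
Proof.
have [lt [wolt init]] := exists_initial_wo K; exists K, lt; split=> // S SK.
have [u _] := infinite_setN0 iK; have [e [_ einj]] := card_le_ex u SK.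
exists e, (fun x => x |` [set y | S y /\ lt (e y) (e x)]); split=> // [x|a x Aa].
  apply: not_card_le_setU1 => // KS; apply: (init (e x)); apply: card_le_trans KS _.
  by apply: (card_le_inj (f := e)) => [y []//|y z [Sy _] [Sz _]]; exact: einj.
move=> akS [ax Sx] xmax; apply: atleast_sub akS => // y [ay Sy]; split=> //.
have [|exy|] := xmax y; [by [] | left | by right].
exact: einj.
Qed.

(** Points are ordered first by the stage of a filtration at which they appear, then within that
    layer by the order from the hypothesis. *)
Lemma last_block_step p (Y Z : Type) W (lt : W -> W -> Prop) :
  [set: K] #<= [set: Y] -> is_card_succ Y Z -> wo lt ->
  (forall S : set X, S #<= [set: Y] -> exists r Q, last_block lt S p r Q) ->
  exists (W' : Type) (lt' : W' -> W' -> Prop), wo lt' /\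
    forall S : set X, S #<= [set: Z] -> exists r Q, last_block lt' S (p + k) r Q.
Proof.
move=> KY [[YZ _] succ] wolt IH.
have iY := infinite_card_le iK KY; have iZ := infinite_card_le iY YZ.
have [ltZ [woltZ init]] := exists_initial_wo Z.
exists (Z * W)%type, (lexprod ltZ lt); split; first exact: wo_lexprod woltZ wolt.
move=> S SZ; have [u _] := infinite_setN0 iZ.
have [e [_ einj]] := card_le_ex u SZ.
pose C z := fat_closure k A [set y | S y /\ (z |` [set t | ltZ t z]) (e y)].
have C_mono z z' : ltZ z z' -> C z `<=` C z'.
  move=> zz'; apply: fat_closureS => y [Sy yz]; split=> //; right.
  case: yz => [->//|yz] /=; exact: wo_trans woltZ _ _ _ yz zz'.
have C_le z : C z #<= [set: Y].
  apply: (fat_closure_card_le iN adA finA) => //; first exact: card_le_trans NK KY.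
  apply: (@card_le_trans _ _ _ (z |` [set t | ltZ t z])).
    by apply: (card_le_inj (f := e)) => [y []//|y t [Sy _] [St _]]; exact: einj.
  (* Segments of the initial order are smaller than [Z], hence at most [Y] since [Z] is its
     successor. *)
  apply: succ; split; first exact: card_leT.
  exact: not_card_le_setU1.
(* The rank [rho x] is the least stage containing [x]; one exists because [x] lies in [C (e x)]. *)
have /choice[rho rhoP] : forall x, exists z, S x ->
    C z x /\ forall t, ltZ t z -> ~ C t x.
  move=> x; have [Sx|nSx] := pselect (S x); last by exists u.
  have [|z Cz zmin] := wf_min (P := fun z => C z x) woltZ.1; last by exists z.
  by exists (e x); apply: sub_fat_closure; split=> //; left.
pose L z := S `&` [set x | rho x = z].
have /choice[rQ rQP] : forall z, exists rQ : (X -> W) * (X -> set X),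
    last_block lt (L z) p rQ.1 rQ.2.
  move=> z; have [|r [Q rQP]] := IH (L z); last by exists (r, Q).
  apply: card_le_trans (C_le z); apply: subset_card_le => x [Sx <-].
  exact: (rhoP x Sx).1.
exists (fun x => (rho x, (rQ (rho x)).1 x)), (fun x => (rQ (rho x)).2 x).
split=> [x y Sx Sy [rxy]|x|a x Aa apk [ax Sx] xmax].
- have [rinj _ _] := rQP (rho y).
  by rewrite rxy => /rinj; apply; split.
- by have [_ Qsmall _] := rQP (rho x); exact: Qsmall.
have [_ _ /(_ a x Aa)] := rQP (rho x); apply=> //.
- have -> : a `&` L (rho x) = a `&` S `&` [set y | rho y = rho x] by rewrite setIA.
  (* Otherwise [a] has more than [k] points of [rho]-rank below [rho x], hence
     lies in some [C z] with [z] below [rho x]. *)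
  apply: atleast_split apk _ => -[s [us ks sS]].
  have [|z zs zmax] := wo_seq_max (s := s) rho woltZ; first by case: (s) ks.
  have slt y : y \in s -> ltZ (rho y) (rho x).
    move=> /sS[[ay Sy] yx].
    by have [[/= ?]|[//|[/= ?]]] := xmax y (conj ay Sy).
  have /(_ x ax) : a `<=` C (rho z).
    apply: fat_closure_closed => //; exists s; split=> // y ys.
    have [[ay Sy] _] := sS y ys; split=> //.
    have [Cy _] := rhoP y Sy.
    by case: (zmax y ys) => [<-//|/C_mono]; exact.
  by have [_] := rhoP x Sx; apply; exact: slt.
move=> y [ay [Sy yx]]; have [[/= _]|[/= |[/= _]]] := xmax y (conj ay Sy).
- by rewrite yx; left.
- by rewrite yx => /(wf_irr woltZ.1).
- by rewrite yx; right.
Qed.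

(** The base costs [k.+1] points and each successor [k] more; at [m = n.-1] this is exactly
    [(n * k).+1]. *)
Lemma last_block_exists m (Z : Type) : is_succ_iter m K Z ->
  exists (W : Type) (lt : W -> W -> Prop), wo lt /\
  forall S : set X, S #<= [set: Z] ->
    exists r Q, last_block lt S (m.+1 * k).+1 r Q.
Proof.
elim: m Z => [|m IH] Z.
  move=> /card_eqPle[_ ZK]; have [W [lt [wolt WP]]] := last_block_base.
  exists W, lt; split=> // S SZ; rewrite mul1n; apply: WP.
  exact: card_le_trans SZ ZK.
move=> [Y [KY YZ]]; have [W [lt [wolt WP]]] := IH Y KY.
rewrite mulSnr -addSn.
exact: last_block_step (succ_iter_card_le KY) YZ wolt WP.
Qed.

End Rank.

(** * The greedy conflict free colouring *)

Theorem theorem2p1 (K N X : Type) (n k : nat) (A : set (set X)) :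
  infinite_set [set: N] ->
  [set: N] #<= [set: K] ->
  regular_card N ->
  (1 <= n)%N -> (1 <= k)%N ->
  is_succ_iter n.-1 K X ->
  almost_disjoint N k A ->
  (forall a, A a -> finite_set a /\ `I_(n * k).+1 #<= a) ->
  exists f : X -> K, conflict_free A f.
Proof.
elim/Pchoice: X => X in A *.
move=> iN NK regN n1 _ KX adA Afin.
have finA a (Aa : A a) := (Afin a Aa).1.
have [W [lt [wolt]]] := last_block_exists iN adA finA NK KX.
move=> /(_ [set: X] (card_lexx _))[r [Q [rinj Qsmall Qlast]]].
have {}rinj : injective r by move=> x y; exact: rinj.
have wor := wo_inv_image wolt rinj.
have [|f [_ fne]] := greedy_coloring (D := [set: K])
    (B := fun x => fat_union k A (Q x)) wor.1.
  by move=> x; exact: (not_card_le_fat_union iN adA finA).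
exists f => a Aa.
have atl : atleast (n.-1.+1 * k).+1 (a `&` [set: X]).
  by rewrite setIT prednK //; apply/atleastP; exact: (Afin a Aa).2.
have [s sE] : exists s : seq X, a = [set` s] by apply/finite_seqP; exact: finA.
have s0 : s != [::].
  case: atl => -[|x t] [] // _ _ /(_ x (mem_head _ _))[].
  by rewrite sE /=; case: (s).
have [x xs xmax] := wo_seq_max r wolt s0.
exists (f x), x; apply/seteqP; split=> [y [ay fyx]|_ ->]; last by rewrite sE.
(* As [x] is last in [a], the set [a] is fat for [Q x]; so any other [y] in [a] is an earlier point
   of the conflict set of [x]. *)
apply: contrapT => /= yx; case: (fne x y) => //.
  apply: fat_union_sub (ay) => //; apply: Qlast => //; first by rewrite sE.
  by move=> z [az _]; apply: xmax; move: az; rewrite sE.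
by have [|/rinj//|] := xmax y; first by move: ay; rewrite sE.
Qed.
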